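(* Let $A=(a_1,\dots,a_n)$ be positive integers with $a_1\le\dots\le a_n=k+1$, let $d_j=\#\{i:a_i=j\}$ (with $d_j=0$ for $j>k+1$), and let $l\ge2$. a) Let $d_l\ge2$, and let $A''\in\mathbb N^n$ be such that its associated multiplicities are $d''_{l-1}=d_{l-1}+1$, $d''_l=d_l-2$, $d''_{l+1}=d_{l+1}+1$, and $d''_i=d_i$ otherwise. Then $W^A/W^{A'}\cong W^{A''}$ as $\mathbb C[e_0,\dots,e_{n-1}]$-modules. b) Let $d_l=1$, $l=\min\{m:d_m\ne0\}$, $l\ne k+1$, $l_1=\min\{m>l:d_m\neq0\}$, and let $A''\in\mathbb N^n$ be such that its associated multiplicities are $d''_{l-1}=d_{l-1}+1$, $d''_l=0$, $d''_{l_1}=d_{l_1}-1$, $d''_{l_1+1}=d_{l_1+1}+1$, and $d''_i=d_i$ otherwise. Then $W^A/W^{A'}\cong W^{A''}$ as $\mathbb C[e_0,\dots,e_{n-1}]$-modules. Here, in both cases, $W^{A'}\subset W^A$ is the submodule described in the context.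
   Context: For a tuple $A=(a_1,\dots,a_n)$ of positive integers (order irrelevant), let $e^{(n)}(z)=\sum_{i=0}^{n-1}e_iz^i$, $s_+=\max(s,0)$, and let $W^A=\mathbb C[e_0,\dots,e_{n-1}]/J^A$, where $J^A$ is generated by the coefficients of $z^m$, $0\le m<\sum_{j=1}^n(i+1-a_j)_+$, in $e^{(n)}(z)^i$, $i\ge1$. The submodule $W^{A'}\subset W^A$: it is the $\mathbb C[e_0,\dots,e_{n-1}]$-submodule of $W^A$ generated by the class of the coefficient of $z^{\sum_{j=1}^{l-1}(l-j)d_j}$ in $e^{(n)}(z)^{l-1}$. The notation is justified as follows. In case a), this submodule is identified with $W^{A'}$, where $A'\in\mathbb N^{n-2}$ has multiplicities $d'_l=d_l-2$, $d'_i=d_i$ ($i\ne l$), via $e_i\mapsto e_{i-2}$ ($i\ge 2$; $e_0,e_1$ act by $0$). In case b), it is identified with $W^{A'}$, where $A'\in\mathbb N^{n-1}$ has multiplicities obtained from $(d_i)$ by decreasing $d_l$ and $d_{l_1}$ by $1$ and increasing $d_{l_1-l+1}$ by $1$, via $e_i\mapsto e_{i-1}$ ($i\ge1$; $e_0$ acts by $0$). *)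

(* Defs.v *)
From HB Require Import structures.
From mathcomp Require Import all_boot all_order all_algebra.
From mathcomp Require Import boolp reals.
From mathcomp Require Export complex.
From mathcomp Require Export mpoly.

Set Implicit Arguments.
Unset Strict Implicit.
Unset Printing Implicit Defensive.

Import GRing.Theory.
Local Open Scope ring_scope.
Local Open Scope quotient_scope.

Section Submodule.
Variables (R : nzRingType) (M : lmodType R).

Record submodule := Submodule {
  submod_pred :> M -> bool;
  submod_predP : submod_closed submod_pred }.

HB.instance Definition _ (N : submodule) :=
  GRing.isSubmodClosed.Build R M (submod_pred N) (submod_predP N).

Definition submod_zmodClosed (N : submodule) : zmodClosed M :=
  Eval hnf in GRing.ZmodClosed.clone M (submod_pred N) _.

(* All finite linear combinations of elements of S, made into a boolean
   predicate by classical logic so that ring_quotient.v applies. *)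
Definition lin_comb (S : M -> Prop) : M -> bool :=
  fun x => `[< exists2 s : seq (R * M),
      forall p, p \in s -> S p.2 & x = \sum_(p <- s) p.1 *: p.2 >].

Fact lin_comb_closed S : submod_closed (lin_comb S).
Proof.
split=> [|a u v /asboolP[s sS ->] /asboolP[t tS ->]]; apply/asboolP.
  by exists [::] => //; rewrite big_nil.
exists ([seq (a * p.1, p.2) | p <- s] ++ t) => [p|].
  by rewrite mem_cat => /orP[/mapP[q /sS Sq ->]|/tS].
rewrite big_cat big_map scaler_sumr; congr (_ + _).
by apply: eq_bigr => p _; rewrite scalerA.
Qed.

Definition submod_gen (S : M -> Prop) : submodule :=
  Submodule (lin_comb_closed S).

End Submodule.

(* ring_quotient.v only gives the quotient a Z-module structure. *)
Section QuotientModule.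
Variables (R : nzRingType) (M : lmodType R) (N : submodule M).
Local Notation Q := (Quotient.quot (submod_zmodClosed N)).

Definition quot_scale (a : R) (x : Q) : Q := \pi_Q (a *: repr x).

Fact pi_scale a x : quot_scale a (\pi_Q x) = \pi_Q (a *: x).
Proof.
rewrite /quot_scale; apply/eqP; rewrite -Quotient.idealrBE -scalerBr.
have [N0 Nlin] := submod_predP N.
rewrite -[X in X \in _]addr0; apply: Nlin => //.
by have /eqP := reprK (\pi_Q x); rewrite -Quotient.idealrBE.
Qed.

Fact quot_scaleA a b x : quot_scale a (quot_scale b x) = quot_scale (a * b) x.
Proof. by elim/quotW: x => x; rewrite (pi_scale b) !pi_scale scalerA. Qed.

Fact quot_scale1 : left_id 1 quot_scale.
Proof. by elim/quotW=> x; rewrite pi_scale scale1r. Qed.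

Fact quot_scaleDr : right_distributive quot_scale +%R.
Proof.
move=> a; elim/quotW=> x; elim/quotW=> y.
rewrite -pi_addr (pi_scale a (x + y)) (pi_scale a x) (pi_scale a y).
by rewrite scalerDr pi_addr.
Qed.

Fact quot_scaleDl x : {morph quot_scale^~ x : a b / a + b}.
Proof. by elim/quotW: x => x a b; rewrite !(pi_scale _ x) scalerDl pi_addr. Qed.

HB.instance Definition _ := GRing.Zmodule_isLmodule.Build R Q
  quot_scaleA quot_scale1 quot_scaleDr quot_scaleDl.

Definition quotMod : lmodType R := Q.
Definition quotMod_class (x : M) : quotMod := \pi_Q x.

End QuotientModule.

Definition mult (A : seq nat) (j : nat) : nat := count_mem j A.

Definition is_min (P : nat -> Prop) (m : nat) : Prop :=
  P m /\ forall m', P m' -> (m <= m')%N.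

Section FusionModule.
Variables (F : comNzRingType) (n : nat).

(* e^(n)(z), with coefficients in F[e_0, ..., e_{n-1}]. *)
Definition epoly : {poly {mpoly F[n]}} := \sum_(i < n) 'X_i *: 'X^i.

Variable A : n.-tuple nat.

(* Truncated subtraction on nat is s_+ here. *)
Definition relJ (p : {mpoly F[n]}) : Prop :=
  exists i m : nat, [/\ (1 <= i)%N,
    (m < \sum_(j < n) (i + 1 - tnth A j))%N & p = (epoly ^+ i)`_m].

(* J^A is the submodule of the regular module {mpoly F[n]}^o generated by
   relJ, i.e., the ideal generated by relJ. *)
Definition idealJ := submod_gen (relJ : {mpoly F[n]}^o -> Prop).

Definition W : lmodType {mpoly F[n]} := quotMod idealJ.

Definition Wclass (p : {mpoly F[n]}) : W := quotMod_class idealJ (p : {mpoly F[n]}^o).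

Definition Wsub_gen (l : nat) : W :=
  Wclass (epoly ^+ l.-1)`_(\sum_(1 <= j < l) (l - j) * mult A j)%N.

(* The submodule denoted W^{A'}; it depends on A and l. *)
Definition Wsub (l : nat) := submod_gen (eq (Wsub_gen l)).

End FusionModule.

Definition lmod_iso (R : nzRingType) (U V : lmodType R) : Prop :=
  exists f : {linear U -> V}, bijective f.

(* Main.v *)
From HB Require Import structures.
Require Import Defs.
From mathcomp Require Import all_boot all_order all_algebra.
From mathcomp Require Import boolp reals.
From mathcomp Require Import zify.

(** Write S_A(i) for the number of vanishing low coefficients of e(z)^i in
    W^A, that is, S_A(i) = sum_j (i + 1 - a_j)_+.  Both parts replace two
    entries p <= q of A by p - 1 and q + 1: in part a) p = q = l, in part b)
    p = l and q = l1.  The convex function s |-> (i + 1 - s)_+ has its only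
    break at i + 1, so S_A'' exceeds S_A by 1 when p - 1 <= i < q and agrees
    with S_A otherwise ([vanishing_spread]).  Hence J^A'' is J^A enlarged by
    the coefficients of z^(S_A(i)) in e(z)^i for l - 1 <= i < q, and the one
    with i = l - 1 is the generator g of W^A'.  It remains to see that g
    generates the others modulo J^A; then W^A / W^A' and W^A'' are quotients
    of the polynomial ring by the same ideal ([quot_gen_iso]).

    In part a) the only index is i = l - 1.  In part b) l is a simple minimum
    of A and A has no entry strictly between l and l1, so
    S_A(i) = i - (l - 1) in the relevant range and g = e_0^(l-1).  Every
    monomial of the coefficient of z^(i-(l-1)) in e(z)^i is a product of i
    variables whose indices add up to i - (l - 1); at least l - 1 of them are
    e_0, so g divides it ([coef_exp_dvd]). *)

Set Implicit Arguments.
Unset Strict Implicit.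
Unset Printing Implicit Defensive.

Import GRing.Theory.
Local Open Scope ring_scope.

(** * Quotients of modules *)

(** Both modules are the quotient of [M] by the common kernel. *)
Lemma iso_of_same_kernel (R : nzRingType) (M U V : lmodType R)
    (phi : {linear M -> U}) (psi : {linear M -> V}) :
  (forall u, exists x, phi x = u) -> (forall v, exists x, psi x = v) ->
  (forall x, phi x = 0 <-> psi x = 0) -> lmod_iso U V.
Proof.
move=> phi_surj psi_surj ker.
have eq_ker x y : phi x = phi y <-> psi x = psi y.
  have [h1 h2] := ker (x - y); rewrite !linearB in h1 h2.
  by split=> e; apply/subr0_eq; [apply: h1 | apply: h2]; rewrite e subrr.
pose s u := projT1 (cid (phi_surj u)).
pose t v := projT1 (cid (psi_surj v)).
have sK u : phi (s u) = u := projT2 (cid (phi_surj u)).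
have tK v : psi (t v) = v := projT2 (cid (psi_surj v)).
pose f u := psi (s u).
have f_lin : linear f.
  by move=> a u v; rewrite /f -linearP; apply/eq_ker; rewrite linearP !sK.
pose F : {linear U -> V} :=
  HB.pack f (GRing.isLinear.Build R U V *:%R f f_lin).
exists F.
exists (phi \o t) => [u|v] /=.
  by rewrite -[RHS]sK; apply/eq_ker; rewrite tK.
by rewrite /f -[RHS]tK; apply/eq_ker; rewrite sK.
Qed.

Section QuotientProjection.
Variables (R : nzRingType) (M : lmodType R) (N : submodule M).

Lemma quotMod_class_linear : linear (quotMod_class N).
Proof.
move=> a x y; rewrite /quotMod_class pi_addr; congr (_ + _).
by rewrite -pi_scale.
Qed.

HB.instance Definition _ :=
  GRing.isLinear.Build R M (quotMod N) *:%R (quotMod_class N)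
    quotMod_class_linear.

Lemma quotMod_class_surj u : exists x, quotMod_class N x = u.
Proof. by exists (repr u); rewrite /quotMod_class reprK. Qed.

Lemma quotMod_class_eq0 x : quotMod_class N x = 0 <-> N x.
Proof.
rewrite -[0](linear0 (quotMod_class N)) -[x in N x]subr0.
rewrite -[N _]/(x - 0 \in submod_zmodClosed N) Quotient.idealrBE.
by split=> [/eqP|/eqP].
Qed.

End QuotientProjection.

Section GeneratedSubmodule.
Variables (R : nzRingType) (M : lmodType R).

Lemma sub_submod_gen (S : M -> Prop) x : S x -> submod_gen S x.
Proof.
move=> Sx; apply/asboolP; exists [:: (1, x)] => [p|].
  by rewrite inE => /eqP->.
by rewrite big_seq1 scale1r.
Qed.

Lemma submod_gen_ker (U : lmodType R) (phi : {linear M -> U}) (S : M -> Prop) x :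
  (forall y, S y -> phi y = 0) -> submod_gen S x -> phi x = 0.
Proof.
move=> phi0 /asboolP[s sS ->]; rewrite linear_sum big_seq big1 // => p /sS Sp.
by rewrite linearZ /= phi0 // scaler0.
Qed.

Lemma submod_gen_eq (g x : M) : submod_gen (eq g) x -> exists c : R, x = c *: g.
Proof.
move=> /asboolP[s sS ->]; exists (\sum_(p <- s) p.1).
by rewrite scaler_suml big_seq [RHS]big_seq; apply: eq_bigr => p /sS <-.
Qed.

End GeneratedSubmodule.

(** The hypotheses say that the submodule generated by [S'] is the one
    generated by [S] and [g]; the rest is the third isomorphism theorem. *)
Lemma quot_gen_iso (R : nzRingType) (M : lmodType R) (S S' : M -> Prop) (g : M) :
  (forall x, S x -> S' x) -> S' g ->
  (forall x, S' x -> S x \/ exists c : R, x = c *: g) ->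
  lmod_iso (quotMod (submod_gen (eq (quotMod_class (submod_gen S) g))))
           (quotMod (submod_gen S')).
Proof.
move=> SS' S'g S'S; set N := submod_gen S; set N' := submod_gen S'.
pose pr := quotMod_class (submod_gen (eq (quotMod_class N g))).
have N_ker (x : M) : S x -> quotMod_class N x = 0.
  by move=> Sx; apply/quotMod_class_eq0/sub_submod_gen.
have N'_ker (x : M) : S' x -> quotMod_class N' x = 0.
  by move=> Sx; apply/quotMod_class_eq0/sub_submod_gen.
apply: (@iso_of_same_kernel _ M _ _ (pr \o quotMod_class N) (quotMod_class N')).
- move=> u; have [v <-] := quotMod_class_surj u.
  by have [x <-] := quotMod_class_surj v; exists x.
- exact: quotMod_class_surj.
move=> x; split=> [/= /quotMod_class_eq0 gx|].
  have [c xcg] := submod_gen_eq gx.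
  have : quotMod_class N (x - c *: g) = 0.
    by rewrite linearB linearZ /= xcg subrr.
  move=> /quotMod_class_eq0 /(submod_gen_ker (phi := quotMod_class N')).
  rewrite linearB linearZ /= (N'_ker g) // scaler0 subr0; apply=> y /SS'.
  exact: N'_ker.
move=> /quotMod_class_eq0; apply: submod_gen_ker => y /S'S[/N_ker /= ->|].
  exact: linear0.
move=> [c ->]; rewrite linearZ /=.
have g0 : pr (quotMod_class N g) = 0.
  exact/quotMod_class_eq0/sub_submod_gen.
by rewrite -[RHS](scaler0 _ c) -g0.
Qed.

(** * Low coefficients of powers of a polynomial *)

(** The coefficient is a sum of products of [i] coefficients of [p] whose
    indices add up to [m]; at most [m] of these indices are nonzero. *)
Lemma coef_exp_dvd (R : comNzRingType) (p : {poly R}) (i m : nat) :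
  exists c, (p ^+ i)`_m = c * p`_0 ^+ (i - m).
Proof.
elim: i m => [|i IHi] m; first by exists (p ^+ 0)`_m; rewrite mulr1.
have term (j : 'I_m.+1) :
    exists c, p`_j * (p ^+ i)`_(m - j) = c * p`_0 ^+ (i.+1 - m).
  have [c ->] := IHi (m - j)%N; case: (posnP j) => [->|j_gt0].
    have [le_mi | lt_im] := leqP m i.
      by exists c; rewrite subn0 subSn // exprS mulrCA.
    (* Here the exponent i.+1 - m vanishes, so any cofactor will do. *)
    exists (p`_0 * (c * p`_0 ^+ (i - (m - 0)))).
    by rewrite (eqP (lt_im : (i.+1 <= m)%N)) mulr1.
  exists (p`_j * c * p`_0 ^+ (i - (m - j) - (i.+1 - m))).
  rewrite -!mulrA -exprD subnK //; have := ltn_ord j; lia.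
have [c Ec] := choice term.
exists (\sum_j c j); rewrite exprS coefM mulr_suml.
by apply: eq_bigr => j _; rewrite Ec.
Qed.

(** * The number of vanishing coefficients *)

Definition vanishing (A : seq nat) (i : nat) : nat := \sum_(a <- A) (i + 1 - a).

Lemma vanishing_tuple n (A : n.-tuple nat) i :
  vanishing A i = (\sum_(j < n) (i + 1 - tnth A j))%N.
Proof. exact: big_tuple. Qed.

(** Grouping equal entries recovers the exponent used for the generator of
    the submodule. *)
Lemma vanishing_mult (A : seq nat) (l : nat) :
  (0 < l)%N -> (forall a, a \in A -> 0 < a)%N ->
  vanishing A l.-1 = (\sum_(1 <= j < l) (l - j) * mult A j)%N.
Proof.
move=> l_gt0; rewrite /vanishing addn1 prednK //.
elim: A => [|a A IHA] A_pos.
  by rewrite big_nil big1 // => j _; rewrite muln0.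
rewrite big_cons IHA => [|b Ab]; last by rewrite A_pos // inE Ab orbT.
have a_gt0 : (0 < a)%N by rewrite A_pos // mem_head.
under [RHS]eq_bigr => j _ do rewrite /mult /= mulnDr.
rewrite big_split /=; congr addn.
have [lt_al | le_la] := ltnP a l; last first.
  rewrite big_nat big1 => [|j /andP[_ lt_jl]]; first lia.
  by rewrite (_ : (a == j) = false) ?muln0 //; lia.
rewrite (bigD1_seq a) ?iota_uniq ?mem_index_iota ?a_gt0 //= eqxx muln1.
by rewrite big1 ?addn0 // => j; rewrite eq_sym => /negPf->; rewrite muln0.
Qed.

Lemma vanishing_spread (A A'' : seq nat) (p q i : nat) :
  (0 < p <= q)%N -> perm_eq [:: p, q & A''] [:: p.-1, q.+1 & A] ->
  vanishing A'' i = (vanishing A i + (p.-1 <= i < q))%N.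
Proof.
move=> le_pq pAA; have := perm_big _ pAA (op := addn) (x := 0%N)
  (P := xpredT) (F := fun a => i + 1 - a)%N.
rewrite !big_cons /= -!/(vanishing _ _); lia.
Qed.

(** The minimal entry [l] is the only one that contributes below [l1]. *)
Lemma vanishing_simple_min (A : seq nat) (l l1 i : nat) :
  (0 < l)%N -> mult A l = 1%N -> is_min (fun m => mult A m <> 0%N) l ->
  is_min (fun m => (l < m)%N /\ mult A m <> 0%N) l1 ->
  (l.-1 <= i < l1)%N -> vanishing A i = (i - l.-1)%N.
Proof.
move=> l_gt0 dl [_ min_l] [_ min_l1] /andP[le_li lt_il1].
have Al : l \in A by rewrite -has_pred1 has_count -/(mult A l) dl.
rewrite /vanishing (perm_big _ (perm_to_rem Al)) big_cons big_seq big1 => [|a].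
  rewrite /= addn0; lia.
move=> a_rem; have count_a : (0 < count_mem a (rem l A))%N.
  by rewrite -has_count has_pred1.
have mult_a : mult A a = ((l == a) + count_mem a (rem l A))%N.
  by rewrite /mult (permP (perm_to_rem Al)).
have ne_la : l != a.
  by apply/eqP=> e; move: mult_a count_a; rewrite -e dl eqxx; lia.
have le_la : (l <= a)%N by apply: min_l; lia.
by have : (l1 <= a)%N; [apply: min_l1; split; lia | lia].
Qed.

(** * Spreading two entries of the tuple *)

(** The criterion common to both parts: of the coefficients that become
    relations when [l, q] is replaced by [l - 1, q + 1], all must be multiples
    of the first one, which generates the submodule. *)
Lemma quot_Wsub_iso (F : comNzRingType) (n l q : nat) (A A'' : n.-tuple nat) :
  (2 <= l <= q)%N -> (forall j, 0 < tnth A j)%N ->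
  perm_eq [:: l, q & A''] [:: l.-1, q.+1 & A] ->
  (forall i, (l.-1 <= i < q)%N ->
     exists c : {mpoly F[n]}, (epoly F n ^+ i)`_(vanishing A i) =
       c * (epoly F n ^+ l.-1)`_(vanishing A l.-1)) ->
  lmod_iso (quotMod (Wsub F A l)) (W F A'').
Proof.
move=> l_ge2 A_pos pAA new_rel.
have spread i := vanishing_spread i (ltac:(lia) : (0 < l <= q)%N) pAA.
have relE (B : n.-tuple nat) p : relJ B p <-> exists i m,
    [/\ (1 <= i)%N, (m < vanishing B i)%N & p = (epoly F n ^+ i)`_m].
  by split=> -[i [m [? lt_m ->]]]; exists i, m;
    split; rewrite // vanishing_tuple in lt_m *.
rewrite /Wsub /Wsub_gen -vanishing_mult; [|lia|by move=> a /tnthP[j ->]].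
apply: quot_gen_iso => [x /relE[i [m [i1 lt_m ->]]]| |x].
- by apply/relE; exists i, m; split; rewrite // spread ltn_addr.
- apply/relE; exists l.-1, (vanishing A l.-1); split=> //; first lia.
  by rewrite spread; lia.
move=> /relE[i [m [i1 lt_m ->]]].
have [lt_mA | le_Am] := ltnP m (vanishing A i).
  by left; apply/relE; exists i, m.
right; have := spread i; case: (boolP (l.-1 <= i < q)%N) => [iq|_] Ei; last lia.
have -> : m = vanishing A i by lia.
exact: new_rel.
Qed.

Theorem proposition4p1 (R : realType) (n k l : nat) (A : n.-tuple nat)
    (A_pos : forall i : 'I_n, (0 < tnth A i)%N)
    (A_sorted : sorted leq A) (A_last : last 0%N A = k.+1)
    (l_ge2 : (2 <= l)%N) :
  (* a) *)
  (forall A'' : n.-tuple nat,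
     (2 <= mult A l)%N ->
     mult A'' l.-1 = (mult A l.-1 + 1)%N ->
     mult A'' l = (mult A l - 2)%N ->
     mult A'' l.+1 = (mult A l.+1 + 1)%N ->
     (forall i, i \notin [:: l.-1; l; l.+1] -> mult A'' i = mult A i) ->
     lmod_iso (quotMod (Wsub R[i] A l)) (W R[i] A''))
  /\
  (* b) *)
  (forall (l1 : nat) (A'' : n.-tuple nat),
     mult A l = 1%N ->
     is_min (fun m => mult A m <> 0%N) l ->
     l <> k.+1 ->
     is_min (fun m => (l < m)%N /\ mult A m <> 0%N) l1 ->
     mult A'' l.-1 = (mult A l.-1 + 1)%N ->
     mult A'' l = 0%N ->
     mult A'' l1 = (mult A l1 - 1)%N ->
     mult A'' l1.+1 = (mult A l1.+1 + 1)%N ->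
     (forall i, i \notin [:: l.-1; l; l1; l1.+1] -> mult A'' i = mult A i) ->
     lmod_iso (quotMod (Wsub R[i] A l)) (W R[i] A'')).
Proof.
split=> [A'' dl d1 d2 d3 d4 | l1 A'' dl min_l _ min_l1 d1 d2 d3 d4 d5].
  apply: (@quot_Wsub_iso _ _ l l) => //; first lia.
    apply/allP=> a _ /=; rewrite -!/(mult _ _).
    have := d4 a; rewrite !inE.
    have [->|?] := eqVneq a l.-1; first lia.
    have [->|?] := eqVneq a l; first lia.
    have [->|?] := eqVneq a l.+1; [lia | move=> /(_ isT); lia].
  move=> i i_l; have -> : i = l.-1 by lia.
  by exists 1; rewrite mul1r.
have [[lt_ll1 dl1] _] := min_l1.
apply: (@quot_Wsub_iso _ _ l l1) => //; first lia.
  apply/allP=> a _ /=; rewrite -!/(mult _ _).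
  have := d5 a; rewrite !inE.
  have [->|?] := eqVneq a l.-1; first lia.
  have [->|?] := eqVneq a l; first lia.
  have [->|?] := eqVneq a l1; first lia.
  have [->|?] := eqVneq a l1.+1; [lia | move=> /(_ isT); lia].
move=> i i_l; rewrite !(vanishing_simple_min _ dl min_l min_l1) //; [|lia..].
rewrite subnn -horner_coef0 horner_exp horner_coef0.
have [c ->] := coef_exp_dvd (epoly R[i] n) i (i - l.-1).
by exists c; rewrite subKn //; lia.
Qed.
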